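(* Let $\{x_k\}_{k\ge 1}$ be a sequence of solutions obtained with FCMRH (for $A\in\mathbb{R}^{n\times n}$) or with FLSLU (for $A\in\mathbb{R}^{m\times n}$), started from $x_0=0$, and let $$\hat q_k(x)=\|U_{k+1}^{\dagger}(Ax-b)\|_2^2$$ be the functional minimized over $\mathcal{R}(Z_k)$ at iteration $k$. Then $$\frac{\hat q_k(x_{k-1})-\hat q_k(x_k)}{\hat q_k(x_k)}\ \ge\ \frac{\sigma_1^2(U_{k+1}^{\dagger})}{\sigma_{k+1}^2(U_{k+1}^{\dagger})}-1=\kappa(U_{k+1}^{\dagger})^2-1\quad\Longrightarrow\quad \|Ax_{k-1}-b\|_2^2\ \ge\ \|Ax_k-b\|_2^2 .$$
   Context: Notation: $v(i)$ is the $i$-th component of a vector $v$; $\mathcal{R}(\cdot)$ is the range; $B^\dagger$ is the Moore–Penrose pseudoinverse; $\sigma_i(B)$ is the $i$-th singular value of $B$ in decreasing order. For $U_{k+1}^\dagger$, which has rank $k+1$, $\kappa(U_{k+1}^\dagger)=\sigma_1(U_{k+1}^\dagger)/\sigma_{k+1}(U_{k+1}^\dagger)$. The quotient in the hypothesis presupposes $\hat q_k(x_k)\ne0$. Data: a real matrix $A$, a right-hand side $b\neq 0$, $x_0=0$ (so $r_0=b$), and iteration-dependent right preconditioners $P_1,P_2,\dots\in\mathbb{R}^{n\times n}$, where $P_k$ may depend on the previous iterates (in the paper $P_k$ is $(W_kL)^{-1}$, or a weighted pseudoinverse of $W_kL$, where $L$ is a regularization matrix and $W_k=W(Lx_{k-1})$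 is a diagonal weight matrix). Flexible Hessenberg process (used by FCMRH; $A\in\mathbb{R}^{n\times n}$). Initialize $p=(1,\dots,n)$. Choose $i$ with $|b(i)|=\|b\|_\infty$, set $\beta=b(i)$, swap $p(1)$ and $p(i)$, set $u_1=b/\beta$, $z_1=P_1u_1$. For $k=1,2,\dots$: set $u=Az_k$; for $j=1,\dots,k$ set $h_{j,k}=u(p(j))$ and then replace $u$ by $u-h_{j,k}u_j$; if $k<n$ and $u\ne0$, choose $i\in\{k+1,\dots,n\}$ maximizing $|u(p(i))|$, set $h_{k+1,k}=u(p(i))$, swap $p(k+1)$ and $p(i)$, set $u_{k+1}=u/h_{k+1,k}$ and $z_{k+1}=P_{k+1}u_{k+1}$; otherwise stop. Flexible generalized Hessenberg process (used by FLSLU; $A\in\mathbb{R}^{m\times n}$). Initialize $q=(1,\dots,m)$, $g=(1,\dots,n)$. Choose $i$ with $|b(i)|=\|b\|_\infty$, set $\beta=b(i)$, $u_1=b/\beta$, swap $q(1)$ and $q(i)$. Set $v=A^Tu_1$, choose $i$ with $|v(i)|=\|v\|_\infty$, set $t_{1,1}=v(i)$, swap $g(1)$ and $g(i)$, set $v_1=v/t_{1,1}$, $z_1=P_1v_1$. For $k=1,2,\dots$: set $u=Az_k$; for $j=1,\dots,k$ set $h_{j,k}=u(q(j))$ and then replace $u$ by $u-h_{j,k}u_j$; if $k<m$ and $u\neq0$, choose $i\in\{k+1,\dots,m\}$ maximizing $|u(q(i))|$, set $h_{k+1,k}=u(q(i))$, swap $q(k+1)$ and $q(i)$, set $u_{k+1}=u/h_{k+1,k}$;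 otherwise stop. Then set $v=A^Tu_{k+1}$; for $j=1,\dots,k$ set $t_{j,k+1}=v(g(j))$ and replace $v$ by $v-t_{j,k+1}v_j$; if $k<n$ and $v\ne0$, choose $i\in\{k+1,\dots,n\}$ maximizing $|v(g(i))|$, set $t_{k+1,k+1}=v(g(i))$, swap $g(k+1)$ and $g(i)$, set $v_{k+1}=v/t_{k+1,k+1}$ and $z_{k+1}=P_{k+1}v_{k+1}$; otherwise stop. Only iterations $k$ for which $u_{k+1}$ is defined (no breakdown) are considered. In both cases, with $Z_k=[z_1,\dots,z_k]$, $U_{k+1}=[u_1,\dots,u_{k+1}]$ and $H_{k+1,k}=(h_{i,j})\in\mathbb{R}^{(k+1)\times k}$ upper Hessenberg, one has $AZ_k=U_{k+1}H_{k+1,k}$ and $b=\beta u_1$, and, up to a row permutation, $U_{k+1}$ is unit lower triangular (trapezoidal). FCMRH and FLSLU (from the respective process) define $x_k=Z_ky_k$, where $y_k=\arg\min_{y\in\mathbb{R}^k}\|H_{k+1,k}y-\beta e_1\|_2^2=\arg\min_{y\in\mathbb{R}^k}\|U_{k+1}^\dagger(AZ_ky-b)\|_2^2$ and $e_1$ is the first canonical vector. *)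

(* Defs.v *)
From HB Require Import structures.
From mathcomp Require Import all_boot all_order all_algebra all_fingroup.
From mathcomp Require Import polyrcf.

Set Implicit Arguments.
Unset Strict Implicit.
Unset Printing Implicit Defensive.

Import Order.TTheory GRing.Theory Num.Theory.
Local Open Scope ring_scope.

(** * Norm, Moore-Penrose pseudoinverse, singular values *)

Definition norm2 (R : rcfType) (m : nat) (v : 'cV[R]_m) : R :=
  Num.sqrt (\sum_i v i 0 ^+ 2).

Definition penrose (R : rcfType) (m n : nat) (B : 'M[R]_(m, n))
    (X : 'M[R]_(n, m)) : bool :=
  [&& B *m X *m B == B, X *m B *m X == X,
      (B *m X)^T == B *m X & (X *m B)^T == X *m B].

Lemma gram_unit (R : rcfType) (m n : nat) (B : 'M[R]_(m, n)) :
  row_free B -> B *m B^T \in unitmx.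
Proof.
move=> Bfree; rewrite -row_free_unit -kermx_eq0; apply/eqP/row_matrixP => i.
rewrite row0; set v := row i _.
have /(congr1 (mulmx^~ v^T)) : v *m (B *m B^T) = 0.
  by apply/sub_kermxP; rewrite row_sub.
rewrite mul0mx mulmxA -mulmxA -trmx_mul => /matrixP/(_ 0 0).
rewrite !mxE => /eqP; rewrite psumr_eq0 => [/allP vB0|j _]; last first.
  by rewrite [X in _ * X]mxE -expr2 sqr_ge0.
have : v *m B = 0.
  apply/rowP => j; have := vB0 j (mem_index_enum _).
  by rewrite [X in _ * X]mxE mulf_eq0 orbb [RHS]mxE => /eqP.
by move/eqP; rewrite mulmx_free_eq0 // => /eqP.
Qed.

Lemma penrose_exists (R : rcfType) (m n : nat) (B : 'M[R]_(m, n)) :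
  exists X, penrose B X.
Proof.
have [r [C [D [-> fC fD]]]] : exists r (C : 'M_(m, r)) (D : 'M_(r, n)),
    [/\ B = C *m D, row_free C^T & row_free D].
  exists (\rank B), (col_base B), (row_base B).
  rewrite mulmx_base row_base_free /row_free mxrank_tr; split=> //.
  exact: col_base_full.
have uD : D *m D^T \in unitmx by exact: gram_unit.
have uC : C^T *m C \in unitmx by have := gram_unit fC; rewrite trmxK.
pose Dr := D^T *m invmx (D *m D^T); pose Cl := invmx (C^T *m C) *m C^T.
have DDr : D *m Dr = 1%:M by rewrite mulmxA mulmxV.
have ClC : Cl *m C = 1%:M by rewrite -mulmxA mulVmx.
have sC : (C *m Cl)^T = C *m Cl.
  by rewrite !trmx_mul trmx_inv !trmx_mul trmxK !mulmxA.
have sD : (Dr *m D)^T = Dr *m D.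
  by rewrite !trmx_mul trmx_inv !trmx_mul trmxK !mulmxA.
clearbody Dr Cl.
have BX : C *m D *m (Dr *m Cl) = C *m Cl.
  by rewrite !mulmxA -(mulmxA C) DDr mulmx1.
have XB : (Dr *m Cl) *m (C *m D) = Dr *m D.
  by rewrite !mulmxA -(mulmxA Dr) ClC mulmx1.
exists (Dr *m Cl); rewrite /penrose BX XB; apply/and4P; split; apply/eqP.
- by rewrite !mulmxA -(mulmxA C) ClC mulmx1.
- by rewrite !mulmxA -(mulmxA Dr) DDr mulmx1.
- exact: sC.
- exact: sD.
Qed.

Lemma penrose_uniq (R : rcfType) (m n : nat) (B : 'M[R]_(m, n)) X Y :
  penrose B X -> penrose B Y -> X = Y.
Proof.
case/and4P=> /eqP X1 /eqP X2 /eqP X3 /eqP X4.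
case/and4P=> /eqP Y1 /eqP Y2 /eqP Y3 /eqP Y4.
have BXY : B *m X = B *m Y.
  have {1}-> : B *m X = B *m Y *m (B *m X) by rewrite mulmxA Y1.
  by rewrite -X3 -Y3 -trmx_mul mulmxA X1 Y3.
have XBY : X *m B = Y *m B.
  have {1}-> : X *m B = X *m B *m (Y *m B) by rewrite -!mulmxA (mulmxA B) Y1.
  by rewrite -X4 -Y4 -trmx_mul -mulmxA (mulmxA B) X1 Y4.
by rewrite -X2 XBY -mulmxA BXY mulmxA Y2.
Qed.

Definition mpinv (R : rcfType) (m n : nat) (B : 'M[R]_(m, n)) : 'M[R]_(n, m) :=
  xchoose (penrose_exists B).

Lemma mpinvP (R : rcfType) (m n : nat) (B : 'M[R]_(m, n)) :
  penrose B (mpinv B).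
Proof. exact: xchooseP. Qed.

(* The real eigenvalues of S, repeated with algebraic multiplicity. *)
Definition eigenvalues (R : rcfType) (n : nat) (S : 'M[R]_n) : seq R :=
  flatten [seq nseq (mup x (char_poly S)) x | x <- rootsR (char_poly S)].

(* [singval B i] is the i-th largest singular value of B, counting from i = 1:
   the square root of the i-th largest eigenvalue of B^T B. *)
Definition singval (R : rcfType) (m n : nat) (B : 'M[R]_(m, n)) (i : nat) : R :=
  nth 0 (sort >=%R [seq Num.sqrt x | x <- eigenvalues (B^T *m B)]) i.-1.

(* Ratio of the largest to the smallest nonzero singular value, so that
   matrices without full column rank are allowed. *)
Definition kappa (R : rcfType) (m n : nat) (B : 'M[R]_(m, n)) : R :=
  singval B 1 / singval B (\rank B).

(** * Hessenberg processes

   Vectors, columns and iterations carry the usual 1-based indices ([u 1],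
   [u 2], ...; [h i j] for the entry (i, j)); values at unused indices are
   irrelevant.  Coordinates and positions are ordinals, hence 0-based: the
   position "k+1" of a permutation is the ordinal of value k. *)

(* The vector w after j passes of the loop  w <- w - c_j u_j. *)
Fixpoint reduce (R : rcfType) (m : nat) (u : nat -> 'cV[R]_m) (c : nat -> R)
    (w : 'cV[R]_m) (j : nat) : 'cV[R]_m :=
  if j is j'.+1 then reduce u c w j' - c j *: u j else w.

(* One step without breakdown: w is reduced against u_1, ..., u_k, a pivot i of
   maximal modulus is chosen among the positions k+1, ..., m of the permutation
   p, positions k+1 and i are swapped (giving p'), and u_{k+1} is the normalized
   remainder.  The coefficients are c_1, ..., c_k and the pivot c_{k+1}.  Any
   maximizing i is allowed.  With k = 0 and p = 1 the pivot is an entry of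
   maximal modulus of the whole vector w, which is the initialization step. *)
Definition pivot_step (R : rcfType) (m k : nat) (w : 'cV[R]_m)
    (u : nat -> 'cV[R]_m) (c : nat -> R) (p p' : 'S_m) : Prop :=
  [/\ forall j : 'I_m, (j < k)%N -> c j.+1 = reduce u c w j (p j) 0,
      reduce u c w k != 0
    & exists s i : 'I_m,
      [/\ s = k :> nat,
          (k <= i)%N /\
          (forall l : 'I_m, (k <= l)%N ->
             `|reduce u c w k (p l) 0| <= `|reduce u c w k (p i) 0|),
          c k.+1 = reduce u c w k (p i) 0,
          p' = (tperm s i * p)%g (* x |-> p (tperm s i x) *)
        & u k.+1 = (c k.+1)^-1 *: reduce u c w k]].

(* Flexible Hessenberg process, run so that u_{k+1} is defined; [p l] is the
   permutation in force at the start of iteration l. *)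
Record flexible_hessenberg (R : rcfType) (n : nat) (A : 'M[R]_n) (b : 'cV[R]_n)
    (P : nat -> 'M[R]_n) (k : nat) (beta : R) (u z : nat -> 'cV[R]_n)
    (h : nat -> nat -> R) (p : nat -> 'S_n) : Prop := FlexibleHessenberg {
  fh_perm0 : p 0 = 1%g;
  fh_init : pivot_step 0 b u (fun=> beta) (p 0) (p 1);
  fh_prec : forall l, (1 <= l <= k)%N -> z l = P l *m u l;
  fh_step : forall l, (1 <= l <= k)%N ->
    pivot_step l (A *m z l) u (h^~ l) (p l) (p l.+1) }.

(* Flexible generalized Hessenberg process, run so that u_{k+1} is defined (the
   step producing v_{k+1} is allowed to break down).  The step l of
   [fgh_stepv] produces v_{l+1} from A^T u_{l+1}; l = 0 is the initialization
   of v_1. *)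
Record flexible_gen_hessenberg (R : rcfType) (m n : nat) (A : 'M[R]_(m, n))
    (b : 'cV[R]_m) (P : nat -> 'M[R]_n) (k : nat) (beta : R)
    (u : nat -> 'cV[R]_m) (v z : nat -> 'cV[R]_n) (h t : nat -> nat -> R)
    (q : nat -> 'S_m) (g : nat -> 'S_n) : Prop := FlexibleGenHessenberg {
  fgh_perm0 : q 0 = 1%g /\ g 0 = 1%g;
  fgh_init : pivot_step 0 b u (fun=> beta) (q 0) (q 1);
  fgh_stepv : forall l, (l < k)%N ->
    pivot_step l (A^T *m u l.+1) v (t^~ l.+1) (g l) (g l.+1);
  fgh_prec : forall l, (1 <= l <= k)%N -> z l = P l *m v l;
  fgh_stepu : forall l, (1 <= l <= k)%N ->
    pivot_step l (A *m z l) u (h^~ l) (q l) (q l.+1) }.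

(** * The solvers *)

(* [w 1, ..., w k] *)
Definition colsmx (R : rcfType) (m : nat) (w : nat -> 'cV[R]_m) (k : nat) :
    'M[R]_(m, k) :=
  \matrix_(i, j) w j.+1 i 0.

(* H_{k+1,k}; the process does not set the entries below the subdiagonal. *)
Definition hessmx (R : rcfType) (h : nat -> nat -> R) (k : nat) :
    'M[R]_(k.+1, k) :=
  \matrix_(i, j) if (i <= j.+1)%N then h i.+1 j.+1 else 0.

(* x = Z_k y for some minimizer y of || H_{k+1,k} y - beta e_1 ||_2^2. *)
Definition ls_iterate (R : rcfType) (n : nat) (beta : R)
    (z : nat -> 'cV[R]_n) (h : nat -> nat -> R) (k : nat) (x : 'cV[R]_n) :
    Prop :=
  let f (y : 'cV[R]_k) :=
    norm2 (hessmx h k *m y - beta *: delta_mx 0 0) ^+ 2 in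
  exists y, (forall y', f y <= f y') /\ x = colsmx z k *m y.

(* x_0 = 0, x_1, ..., x_k are FCMRH iterates and u_1, ..., u_{k+1} the vectors
   of the underlying process. *)
Definition fcmrh (R : rcfType) (n : nat) (A : 'M[R]_n) (b : 'cV[R]_n)
    (P : nat -> 'M[R]_n) (k : nat) (u x : nat -> 'cV[R]_n) : Prop :=
  exists beta z h p,
    [/\ flexible_hessenberg A b P k beta u z h p, x 0 = 0
      & forall l, (1 <= l <= k)%N -> ls_iterate beta z h l (x l)].

Definition flslu (R : rcfType) (m n : nat) (A : 'M[R]_(m, n)) (b : 'cV[R]_m)
    (P : nat -> 'M[R]_n) (k : nat) (u : nat -> 'cV[R]_m)
    (x : nat -> 'cV[R]_n) : Prop :=
  exists beta v z h t q g,
    [/\ flexible_gen_hessenberg A b P k beta u v z h t q g, x 0 = 0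
      & forall l, (1 <= l <= k)%N -> ls_iterate beta z h l (x l)].

Definition qhat (R : rcfType) (m n : nat) (A : 'M[R]_(m, n)) (b : 'cV[R]_m)
    (u : nat -> 'cV[R]_m) (k : nat) (x : 'cV[R]_n) : R :=
  norm2 (mpinv (colsmx u k.+1) *m (A *m x - b)) ^+ 2.

(* Main.v *)
Require Import Defs.
From HB Require Import structures.
From mathcomp Require Import all_boot all_order all_algebra all_fingroup.
From mathcomp Require Import polyrcf complex.

(* Each residual A x_l - b with l <= k, including -b for l = 0, lies in the
   range of U = U_{k+1}, because A Z_l = U_{l+1} H_{l+1,l} and b = beta u_1.
   Pivoting makes U unit lower trapezoidal up to a row permutation, so U has
   full column rank and its range is that of (U^+)^T.  For r in this range
     sigma_{k+1}^2 |r|^2 <= |U^+ r|^2 <= sigma_1^2 |r|^2,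
   the lower bound failing in general outside of it.  The hypothesis says
   sigma_1^2 |U^+ r_k|^2 <= sigma_{k+1}^2 |U^+ r_{k-1}|^2, and the bounds for
   r_k and r_{k-1} turn it into |r_k| <= |r_{k-1}|. *)

Set Implicit Arguments.
Unset Strict Implicit.
Unset Printing Implicit Defensive.

Import Order.TTheory GRing.Theory Num.Theory.
Local Open Scope ring_scope.

(** * Norms, ranks and characteristic polynomials *)

Lemma norm2_sqr (R : rcfType) (m : nat) (v : 'cV[R]_m) :
  norm2 v ^+ 2 = \sum_i v i 0 ^+ 2.
Proof. by rewrite sqr_sqrtr // sumr_ge0 // => i _; rewrite sqr_ge0. Qed.

Lemma norm2_sqr_mx (R : rcfType) (m : nat) (v : 'cV[R]_m) :
  norm2 v ^+ 2 = (v^T *m v) 0 0.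
Proof. by rewrite norm2_sqr !mxE; apply: eq_bigr => i _; rewrite mxE expr2. Qed.

(** A vector w B^T killed by B has squared norm w B^T B w^T = 0, so multiplying B^T by B on the
    right loses no rank. *)
Lemma mxrank_gram (R : rcfType) (m n : nat) (B : 'M[R]_(m, n)) :
  \rank (B^T *m B) = \rank B.
Proof.
rewrite -(mxrank_tr B); apply/mxrank_injP.
rewrite -submx0; apply/rV_subP => v; rewrite sub_capmx => /andP[/submxP[w ->]].
move=> /sub_kermxP wB0; rewrite submx0; apply/eqP; apply/rowP => j; rewrite [RHS]mxE.
have : norm2 (w *m B^T)^T ^+ 2 = 0.
  by rewrite norm2_sqr_mx trmxK trmx_mul trmxK mulmxA wB0 mul0mx mxE.
rewrite norm2_sqr => /psumr_eq0P w0; apply/eqP; rewrite -sqrf_eq0.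
by have /eqP := w0 (fun i _ => sqr_ge0 _) j isT; rewrite mxE.
Qed.

(** The row space is the direct sum of the coordinate lines at the nonzero diagonal entries. *)
Lemma mxrank_diag (F : fieldType) (n : nat) (d : 'rV[F]_n) :
  \rank (diag_mx d) = #|[pred i | d 0 i != 0]|.
Proof.
have -> : \rank (diag_mx d) =
    \rank (\sum_(i | d 0 i != 0) <<delta_mx 0 i : 'rV[F]_n>>)%MS.
  apply/eqmx_rank/andP; split.
    apply/row_subP => i; rewrite row_diag_mx.
    have [->|di0] := eqVneq (d 0 i) 0; first by rewrite scale0r sub0mx.
    by apply: (sumsmx_sup i) => //; rewrite genmxE scalemx_sub.
  apply/sumsmx_subP => i di0; rewrite genmxE -[delta_mx 0 i]scale1r.
  by rewrite -(mulVf di0) -scalerA scalemx_sub // -row_diag_mx row_sub.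
rewrite (mxdirectP _) /=; last exact: mxdirect_delta.
rewrite -sum1_card; apply: eq_bigr => i _.
by rewrite genmxE mxrank_delta.
Qed.

Lemma eigenvalues_perm (R : rcfType) (n : nat) (S : 'M[R]_n) (s : seq R) :
  char_poly S = \prod_(x <- s) ('X - x%:P) -> perm_eq (eigenvalues S) s.
Proof.
move=> chS; rewrite -(permPr (perm_count_undup s)) /eigenvalues.
under eq_map => x do rewrite chS mu_prod_XsubC.
apply: perm_flatten; apply: perm_map; apply: uniq_perm; rewrite ?undup_uniq //.
  by apply: sorted_uniq (sorted_roots _ _ _); [exact: lt_trans | exact: ltxx].
move=> x; have nz := monic_neq0 (char_poly_monic S).
by rewrite mem_undup -(roots_on_rootsR nz) chS /= root_prod_XsubC.
Qed.

Lemma char_poly_conj (R : comNzRingType) (n : nat) (P Q A : 'M[R]_n) :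
  P *m Q = 1%:M -> char_poly (P *m A *m Q) = char_poly A.
Proof.
move=> PQ; have QP := mulmx1C PQ.
rewrite /char_poly /char_poly_mx !map_mxM /=.
set P' := map_mx _ P; set Q' := map_mx _ Q; set A' := map_mx _ A.
have PQ' : P' *m Q' = 1%:M by rewrite -map_mxM PQ map_mx1.
have -> : 'X%:M = P' *m 'X%:M *m Q' by rewrite scalar_mxC -mulmxA PQ' mulmx1.
rewrite -mulmxBl -mulmxBr !det_mulmx mulrAC -det_mulmx PQ' det1 mul1r.
by rewrite [P' *m _]scalar_mxC -mulmxA PQ' mulmx1.
Qed.

(** * Spectral decomposition of B^T B *)

Local Open Scope sesquilinear_scope.

Lemma conj_quad_diag (C : numClosedFieldType) (n : nat) (d : 'rV[C]_n)
    (w : 'cV[C]_n) :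
  (w^t* *m diag_mx d *m w) 0 0 = \sum_i d 0 i * `|w i 0| ^+ 2.
Proof.
rewrite -mulmxA mul_diag_mx mxE; apply: eq_bigr => i _.
by rewrite !mxE normCK mulrCA (mulrC (w i 0)^*).
Qed.

(* [w r i] is the squared modulus of the i-th coordinate of r in an orthonormal
   eigenbasis of B^T B, taken over R[i] because the library's spectral theorem
   needs an algebraically closed field. *)
Lemma gram_spectral (R : rcfType) (m n : nat) (B : 'M[R]_(m, n)) :
  exists (d : 'I_n -> R) (w : 'cV[R]_n -> 'I_n -> R),
    [/\ perm_eq (eigenvalues (B^T *m B)) (codom d),
        (forall i, 0 <= d i) /\ #|[pred i | d i != 0]| = \rank B,
        forall r i, 0 <= w r i,
        forall r, norm2 r ^+ 2 = \sum_i w r i /\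
                  norm2 (B *m r) ^+ 2 = \sum_i d i * w r i
      & forall r i, w (B^T *m B *m r) i = d i ^+ 2 * w r i].
Proof.
set S := B^T *m B; pose toC := real_complex R.
pose SC := map_mx toC S; pose V := spectralmx SC.
have toC_real k : toC k \is Num.real by rewrite complex_real.
have conj_toC k l (M : 'M[R]_(k, l)) : (map_mx toC M)^t* = map_mx toC M^T.
  by apply/matrixP => i j; rewrite !mxE; apply/CrealP/toC_real.
have SCh : SC \is hermsymmx.
  apply: realsym_hermsym; last by apply/mxOverP => i j; rewrite mxE toC_real.
  apply/is_hermitianmxP; rewrite expr0 scale1r map_mx_id // map_trmx.
  by rewrite trmx_mul trmxK.
have VU : V \is unitarymx := spectral_unitarymx SC.
have VV : V^t* *m V = 1%:M by rewrite -invmx_unitary // mulVmx ?unitarymx_unit.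
pose d i := complex.Re (spectral_diag SC 0 i).
have dE : spectral_diag SC = \row_i toC (d i).
  apply/rowP => i; rewrite mxE; apply/esym/RRe_real.
  by have /mxOverP := hermitian_spectral_diag_real SCh; apply.
have SE : SC = V^t* *m diag_mx (\row_i toC (d i)) *m V.
  have /hermitian_normalmx/orthomx_spectralP {1}-> := SCh.
  by rewrite -dE invmx_unitary.
pose W (r : 'cV[R]_n) := V *m map_mx toC r.
pose w r i := complex.Re (W r i 0) ^+ 2 + complex.Im (W r i 0) ^+ 2.
have wE r i : toC (w r i) = `|W r i 0| ^+ 2 by exact: add_Re2_Im2.
have VV' : V *m V^t* = 1%:M by exact/unitarymxP.
have diagE : diag_mx (\row_i toC (d i)) = V *m SC *m V^t*.
  by rewrite SE !mulmxA VV' mul1mx -mulmxA VV' mulmx1.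
have SCB : SC = (map_mx toC B)^t* *m map_mx toC B by rewrite conj_toC -map_mxM.
exists d, w; split.
- apply: eigenvalues_perm; apply: (map_poly_inj toC); rewrite map_char_poly.
  rewrite -/SC SE big_map rmorph_prod big_enum.
  under [RHS]eq_bigr do rewrite rmorphB /= map_polyX map_polyC.
  set D := diag_mx _; transitivity (char_poly D).
    exact: char_poly_conj.
  rewrite char_poly_trig; last exact: diag_mx_is_trig.
  by apply: eq_bigr => i _; rewrite !mxE eqxx mulr1n.
- split=> [i|].
    (* Entry (i, i) of V B^* B V^* is the squared norm of B applied to the i-th eigenvector. *)
    have := congr1 (fun M : 'M_n => M i i) diagE.
    rewrite SCB !mulmxA -{1}[V]trmxCK -map_mxM -trmx_mul -mulmxA.
    rewrite !mxE eqxx mulr1n => dE'; rewrite -ler0c -/toC dE' sumr_ge0 // => j _.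
    by rewrite !mxE mulrC -normCK exprn_ge0.
  rewrite -mxrank_gram -(mxrank_map toC) -/SC SE mxrankMfree; last first.
    by rewrite row_free_unit unitarymx_unit.
  rewrite eqmxMfull; last by rewrite row_full_unit unitarymx_unit ?trmxC_unitary.
  by rewrite mxrank_diag; apply: eq_card => i; rewrite !inE mxE fmorph_eq0.
- by move=> r i; rewrite addr_ge0 ?sqr_ge0.
- have WD r : (W r)^t* = (map_mx toC r)^t* *m V^t* by rewrite trmx_mul map_mxM.
  move=> r; split; apply: (complexI (R := R)); rewrite norm2_sqr_mx.
    transitivity (((W r)^t* *m diag_mx (const_mx 1) *m W r) 0 0).
      rewrite diag_const_mx mulmx1 WD mulmxA -(mulmxA _ (V^t*)) VV mulmx1.
      by rewrite conj_toC -map_mxM [RHS]mxE.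
    rewrite conj_quad_diag rmorph_sum; apply: eq_bigr => i _.
    by rewrite mxE mul1r -wE.
  transitivity (((W r)^t* *m diag_mx (\row_i toC (d i)) *m W r) 0 0).
    set D := diag_mx _.
    have -> : (W r)^t* *m D *m W r = (map_mx toC r)^t* *m SC *m map_mx toC r.
      by rewrite WD SE !mulmxA.
    by rewrite conj_toC -!map_mxM [RHS]mxE trmx_mul !mulmxA.
  rewrite conj_quad_diag rmorph_sum; apply: eq_bigr => i _.
  by rewrite mxE -wE -rmorphM.
(* In the eigenbasis B^T B scales coordinate i by [d i], hence its squared modulus by [d i ^+ 2]. *)
- move=> r i; apply: (complexI (R := R)); rewrite rmorphM rmorphXn /=.
  rewrite -/toC !wE /W map_mxM -/SC SE !mulmxA VV' mul1mx -mulmxA -/(W r).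
  by rewrite mul_diag_mx 2!mxE normrM exprMn real_normK.
Qed.

Local Close Scope sesquilinear_scope.

(** * Extreme nonzero singular values *)

(** In decreasing order the k+1 nonzero entries fill the indices 0 to k and the zeros follow, so
    index k holds the smallest nonzero entry. *)
Lemma sort_ge_count_neq0 (R : realDomainType) (s : seq R) (k : nat) :
  (forall x, x \in s -> 0 <= x) -> count (fun x => x != 0) s = k.+1 ->
  let t := sort >=%R s in
  [/\ forall x, x \in s -> x <= nth 0 t 0, 0 < nth 0 t k
    & forall x, x \in s -> x != 0 -> nth 0 t k <= x].
Proof.
move=> s_ge0 cnt t.
have mem_t : t =i s by move=> x; rewrite mem_sort.
have cnt_t : count (fun x => x != 0) t = k.+1 by rewrite count_sort.
have t_anti i j : (i <= j)%N -> (j < size t)%N -> nth 0 t j <= nth 0 t i.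
  move=> ij jt; apply: (@sorted_leq_nth _ >=%R).
  - by move=> x y z yx zy; apply: le_trans zy yx.
  - exact: lexx.
  - by apply: sort_sorted => x y; apply: le_total.
  - exact: leq_ltn_trans ij jt.
  - exact: jt.
  - exact: ij.
have t_ge0 j : 0 <= nth 0 t j.
  have [jt|/(nth_default 0)-> //] := ltnP j (size t).
  by apply: s_ge0; rewrite -mem_t mem_nth.
have kt : (k < size t)%N by rewrite -cnt_t count_size.
split=> [x||x]; rewrite -?mem_t.
- by case/(nthP 0) => i it <-; apply: t_anti.
(* If entry k vanished, so would all later ones, leaving at most k nonzero entries. *)
- rewrite lt_def t_ge0 andbT; apply: contra_eqN cnt_t => /eqP tk0.
  rewrite -(cat_take_drop k t) count_cat.
  have -> : count (fun x => x != 0) (drop k t) = 0%N.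
    apply/eqP; rewrite -leqn0 leqNgt -has_count -all_predC; apply/allP => x.
    case/(nthP 0) => i; rewrite size_drop ltn_subRL nth_drop => it <- /=.
    by rewrite negbK eq_le t_ge0 andbT -[leRHS]tk0 t_anti ?leq_addr.
  by rewrite addn0 ltn_eqF // ltnS (leq_trans (count_size _ _)) // size_take kt.
(* A nonzero entry at index i makes entries 0 to i nonzero, whence i <= k. *)
- case/(nthP 0) => i it <- ti0; rewrite t_anti // -ltnS -cnt_t.
  rewrite -(cat_take_drop i.+1 t) count_cat.
  apply: leq_trans (leq_addr _ _); rewrite -[X in (X <= _)%N](size_takel it).
  apply/eq_leq/esym/eqP; rewrite -all_count; apply/allP => y /(nthP 0)[j].
  rewrite size_takel // ltnS => ji <-; rewrite nth_take // gt_eqF //.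
  by apply: lt_le_trans (t_anti _ _ ji it); rewrite lt_def ti0 t_ge0.
Qed.

(** Both norms are sums over the same eigencoordinates, weighted by 1 and by [d i]. The lower bound
    is stated on the range of B^T, where the coordinates with [d i = 0] vanish. *)
Lemma singval_bounds (R : rcfType) (m n : nat) (B : 'M[R]_(m, n)) (k : nat) :
  \rank B = k.+1 ->
  [/\ forall r, norm2 (B *m r) ^+ 2 <= singval B 1 ^+ 2 * norm2 r ^+ 2,
      0 < singval B k.+1
    & forall s, singval B k.+1 ^+ 2 * norm2 (B^T *m s) ^+ 2 <=
                norm2 (B *m (B^T *m s)) ^+ 2].
Proof.
move=> rkB; have [d [w [eig [d_ge0 card_d] w_ge0 normE wGram]]] := gram_spectral B.
pose e := [seq Num.sqrt x | x <- eigenvalues (B^T *m B)].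
have sqrt_in i : Num.sqrt (d i) \in e.
  by apply: map_f; rewrite (perm_mem eig) codom_f.
have e_ge0 x : x \in e -> 0 <= x by case/mapP => y _ ->; apply: sqrtr_ge0.
have cnt_e : count (fun x => x != 0) e = k.+1.
  rewrite count_map (seq.permP eig) count_map -rkB -card_d cardE.
  rewrite size_filter /enum_mem filter_predT.
  by apply: eq_count => i /=; rewrite sqrtr_eq0 le_eqVlt ltNge d_ge0 orbF.
have [ub lb_gt0 lb] := sort_ge_count_neq0 e_ge0 cnt_e.
split=> [r||s]; [|exact: lb_gt0|].
  have [-> ->] := normE r; rewrite mulr_sumr ler_sum // => i _.
  rewrite ler_wpM2r // -[d i]sqr_sqrtr // lerXn2r ?nnegrE ?sqrtr_ge0 //.
    exact: le_trans (sqrtr_ge0 _) (ub _ (sqrt_in i)).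
  exact: ub.
(* Since B^T = B^T B B^+, the coordinates acquire the factor [d i ^+ 2], which removes the kernel of
   B. *)
have -> : B^T *m s = B^T *m B *m (mpinv B *m s).
  have /and4P[/eqP BXB _ /eqP BXT _] := mpinvP B.
  by rewrite !mulmxA -(mulmxA B^T) -{1}BXB trmx_mul BXT.
have [-> ->] := normE (B^T *m B *m (mpinv B *m s)).
rewrite mulr_sumr ler_sum // => i _; rewrite wGram.
have [->|di0] := eqVneq (d i) 0; first by rewrite expr0n /= !(mul0r, mulr0).
rewrite ler_wpM2r ?mulr_ge0 ?sqr_ge0 // -[leRHS]sqr_sqrtr //.
rewrite lerXn2r ?nnegrE ?sqrtr_ge0 ?(ltW lb_gt0) // lb //.
by rewrite sqrtr_eq0 le_eqVlt ltNge d_ge0 orbF.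
Qed.

(** * Triangular structure of the Hessenberg vectors *)

(* Row l of the permuted matrix and column u_{j+1} are both counted from 0. *)
Definition unit_lower (R : rcfType) (m k : nat) (u : nat -> 'cV[R]_m)
    (p : 'S_m) : Prop :=
  forall (j : nat) (l : 'I_m), (j < k)%N -> (l <= j)%N ->
    u j.+1 (p l) 0 = (l == j :> nat)%:R.

Lemma reduceE (R : rcfType) (m : nat) (u : nat -> 'cV[R]_m) (c : nat -> R)
    (w : 'cV[R]_m) (k : nat) :
  reduce u c w k = w - \sum_(j < k) c j.+1 *: u j.+1.
Proof.
elim: k => [|k IHk] /=; first by rewrite big_ord0 subr0.
by rewrite IHk big_ord_recr /= opprD addrA.
Qed.

(** Subtracting the multiple of u_{j+1} clears position j, where that vector is 1; later vectors are
    0 there and keep it cleared. *)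
Lemma reduce_eq0 (R : rcfType) (m k : nat) (u : nat -> 'cV[R]_m)
    (c : nat -> R) (w : 'cV[R]_m) (p : 'S_m) :
  unit_lower k u p ->
  (forall j : 'I_m, (j < k)%N -> c j.+1 = reduce u c w j (p j) 0) ->
  forall l : 'I_m, (l < k)%N -> reduce u c w k (p l) 0 = 0.
Proof.
elim: k => // k IHk low cE l; rewrite ltnS => lk /=.
rewrite !mxE (low k l) //; have [lk'|] := eqVneq (l : nat) k.
  by rewrite mulr1 -lk' -cE ?subrr // lk'.
rewrite mulr0 subr0 => neq_lk; apply: IHk.
- by move=> j i jk; apply: low; rewrite ltnS ltnW.
- by move=> j jk; apply: cE; rewrite ltnS ltnW.
- by rewrite ltn_neqAle neq_lk.
Qed.

(** The invariant of both processes: the swap moves only positions from k on (0-based), so the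
    pattern of the earlier vectors survives. The last conclusion is one column of the Hessenberg
    relation. *)
Lemma pivot_step_unit_lower (R : rcfType) (m k : nat) (w : 'cV[R]_m)
    (u : nat -> 'cV[R]_m) (c : nat -> R) (p p' : 'S_m) :
  unit_lower k u p -> pivot_step k w u c p p' ->
  [/\ (k < m)%N, unit_lower k.+1 u p'
    & w = \sum_(j < k.+1) c j.+1 *: u j.+1].
Proof.
move=> low [cE w_neq0 [s [i [sk [ki imax] ck -> uk]]]].
have w0 := reduce_eq0 low cE.
(* A zero pivot would kill the whole remainder: reduction clears the positions before k, maximality
   the others. *)
have ck0 : c k.+1 != 0.
  apply: contra w_neq0 => /eqP ck0; apply/eqP/colP => x; rewrite mxE.
  have [l ->] : exists l, x = p l by exists (p^-1%g x); rewrite permKV.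
  have [/w0 //|/imax] := ltnP l k.
  by rewrite -ck ck0 normr0 normr_le0 => /eqP.
split; first by rewrite -sk ltn_ord.
- move=> j l; rewrite ltnS leq_eqVlt permM => /predU1P[->|jk] lj.
    rewrite uk mxE; move: lj; rewrite leq_eqVlt => /predU1P[lk|lk].
      have -> : l = s by apply: val_inj; rewrite /= lk sk.
      by rewrite tpermL -ck mulVf // sk eqxx.
    rewrite tpermD ?w0 ?mulr0 // ?ltn_eqF //.
      by rewrite -val_eqE /= sk gtn_eqF.
    by rewrite -val_eqE /= gtn_eqF // (leq_trans lk).
  have lk := leq_ltn_trans lj jk.
  rewrite tpermD ?low //; first by rewrite -val_eqE /= sk gtn_eqF.
  by rewrite -val_eqE /= gtn_eqF // (leq_trans lk).
- rewrite big_ord_recr /= uk scalerA mulfV // scale1r reduceE.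
  by rewrite addrC subrK.
Qed.

(** The rows at the first k positions of [p] form a unit lower triangular block, of determinant
    1. *)
Lemma unit_lower_rank (R : rcfType) (m k : nat) (u : nat -> 'cV[R]_m)
    (p : 'S_m) :
  (k <= m)%N -> unit_lower k u p -> \rank (colsmx u k) = k.
Proof.
move=> km low; set U := colsmx u k.
pose L := rowsub (fun i : 'I_k => p (widen_ord km i)) U.
have L_unit : L \in unitmx.
  rewrite unitmxE det_trig.
    by rewrite big1 ?unitr1 // => i _; rewrite !mxE low ?eqxx.
  by apply/is_trig_mxP => i j ij; rewrite !mxE low ?ltn_eqF // ltnW.
apply/eqP; rewrite eqn_leq rank_leq_col /= -{1}(mxrank_unit L_unit).
exact/mxrankS/rowsub_sub.
Qed.

Lemma sum_sub_colsmx (R : rcfType) (m k l : nat) (u : nat -> 'cV[R]_m)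
    (c : nat -> R) :
  (l <= k)%N ->
  ((\sum_(j < l) c j.+1 *: u j.+1)^T <= (colsmx u k)^T)%MS.
Proof.
move=> lk; rewrite linear_sum /= summx_sub // => j _.
rewrite linearZ /= scalemx_sub //.
have -> : (u j.+1)^T = row (widen_ord lk j) (colsmx u k)^T.
  by apply/rowP => i; rewrite !mxE.
exact: row_sub.
Qed.

(** Stated with the recurrence for [u] alone, which the two processes share. *)
Lemma hessenberg_residual (R : rcfType) (m n : nat) (A : 'M[R]_(m, n))
    (b : 'cV[R]_m) (k : nat) (beta : R) (u : nat -> 'cV[R]_m)
    (z : nat -> 'cV[R]_n) (h : nat -> nat -> R) (q : nat -> 'S_m) :
  pivot_step 0 b u (fun=> beta) (q 0) (q 1) ->
  (forall l, (1 <= l <= k)%N ->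
     pivot_step l (A *m z l) u (h^~ l) (q l) (q l.+1)) ->
  \rank (colsmx u k.+1) = k.+1 /\
  forall l (y : 'cV_l), (l <= k)%N ->
    exists g, A *m (colsmx z l *m y) - b = colsmx u k.+1 *m g.
Proof.
move=> init step.
(* The invariant is vacuous for no vectors, so the initialization is its first step and yields b =
   beta u_1. *)
have [lt0m low1 bE] := pivot_step_unit_lower (k := 0) (fun j l => ltac:(done)) init.
have low l : (l <= k)%N -> (l < m)%N /\ unit_lower l.+1 u (q l.+1).
  elim: l => // l IHl lk; have [_ lowl] := IHl (ltnW lk).
  by have [] := pivot_step_unit_lower lowl (step l.+1 lk).
have [km lowk] := low k (leqnn k).
split; first exact: unit_lower_rank lowk.
move=> l y lk.
suff /submxP[g gE] : ((A *m (colsmx z l *m y) - b)^T <= (colsmx u k.+1)^T)%MS.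
  by exists g^T; rewrite -[LHS]trmxK gE trmx_mul trmxK.
rewrite linearB /= addmx_sub ?eqmx_opp //; last first.
  by rewrite bE (sum_sub_colsmx u (fun=> beta)).
have -> : A *m (colsmx z l *m y) = \sum_(j < l) y j 0 *: (A *m z j.+1).
  rewrite mulmxA; apply/colP => i; rewrite summxE !mxE.
  apply: eq_bigr => j _; rewrite !mxE mulrC; congr (_ * _).
  by apply: eq_bigr => a _; rewrite !mxE.
rewrite linear_sum /= summx_sub // => j _; rewrite linearZ /= scalemx_sub //.
have jk : (j < k)%N := leq_trans (ltn_ord j) lk.
have [_ lowj] := low j (ltnW jk).
have [_ _ ->] := pivot_step_unit_lower lowj (step j.+1 jk).
exact: (sum_sub_colsmx u (h^~ j.+1)).
Qed.

(** * Comparison of the residuals *)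

Lemma mpinv_residual_le (R : rcfType) (m k : nat) (U : 'M[R]_(m, k.+1))
    (g g' : 'cV[R]_k.+1) :
  \rank U = k.+1 ->
  let Ud := mpinv U in
  let q := norm2 (Ud *m (U *m g)) ^+ 2 in
  let q' := norm2 (Ud *m (U *m g')) ^+ 2 in
  q != 0 ->
  singval Ud 1 ^+ 2 / singval Ud k.+1 ^+ 2 - 1 = kappa Ud ^+ 2 - 1 /\
  ((q' - q) / q >= singval Ud 1 ^+ 2 / singval Ud k.+1 ^+ 2 - 1 ->
   norm2 (U *m g') ^+ 2 >= norm2 (U *m g) ^+ 2).
Proof.
move=> rkU Ud q q' q_neq0.
have /and4P[/eqP UXU _ /eqP UXT _] := mpinvP U; rewrite -/Ud in UXU UXT.
(* Full column rank lets U be cancelled in U U^+ U = U. This gives U^+ rank k+1, the index of the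
   denominator in [kappa]. *)
have UdU : Ud *m U = 1%:M.
  have Ufree : row_free U^T by rewrite /row_free mxrank_tr rkU.
  apply: trmx_inj; apply: (row_free_inj Ufree).
  by rewrite -!trmx_mul mulmxA UXU mulmx1.
have rkUd : \rank Ud = k.+1.
  apply/eqP; rewrite eqn_leq rank_leq_row /= -{1}(mxrank1 R k.+1) -UdU.
  exact: mxrankM_maxl.
split; first by rewrite /kappa rkUd expr_div_n.
(* By symmetry of U U^+, the range of U lies in that of (U^+)^T, where the lower bound applies. *)
have UE h : U *m h = Ud^T *m (U^T *m (U *m h)).
  by rewrite !mulmxA -trmx_mul UXT UXU.
have [ub sk_gt0 lb] := singval_bounds rkUd.
have q_gt0 : 0 < q by rewrite lt_def q_neq0 sqr_ge0.
have lbq : singval Ud k.+1 ^+ 2 * norm2 (U *m g) ^+ 2 <= q.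
  by rewrite /q UE; apply: lb.
have ubq' : q' <= singval Ud 1 ^+ 2 * norm2 (U *m g') ^+ 2 by apply: ub.
(* A vanishing sigma_1 would force q = 0 through the upper bound. *)
have s1_gt0 : 0 < singval Ud 1 ^+ 2.
  rewrite lt_def sqr_ge0 andbT; apply: contraTneq q_gt0 => s1_0.
  by rewrite -leNgt -[leRHS](mul0r (norm2 (U *m g) ^+ 2)) -s1_0 ub.
(* The hypothesis becomes sigma_1^2 q <= q' sigma_{k+1}^2. The goal, scaled by sigma_1^2
   sigma_{k+1}^2, then follows by inserting [lbq] before it and [ubq'] after it. *)
rewrite mulrBl divff // lerD2r.
rewrite ler_pdivrMr ?exprn_gt0 // mulrAC ler_pdivlMr // => hyp.
rewrite -(ler_pM2l (mulr_gt0 s1_gt0 (exprn_gt0 2 sk_gt0))).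
rewrite -mulrA (le_trans (ler_wpM2l (ltW s1_gt0) lbq)) //.
by rewrite (le_trans hyp) // [leRHS]mulrAC ler_wpM2r ?sqr_ge0.
Qed.

Lemma hessenberg_residual_le (R : rcfType) (m n : nat) (A : 'M[R]_(m, n))
    (b : 'cV[R]_m) (k : nat) (beta : R) (u : nat -> 'cV[R]_m)
    (z x : nat -> 'cV[R]_n) (h : nat -> nat -> R) (q : nat -> 'S_m) :
  (1 <= k)%N ->
  pivot_step 0 b u (fun=> beta) (q 0) (q 1) ->
  (forall l, (1 <= l <= k)%N ->
     pivot_step l (A *m z l) u (h^~ l) (q l) (q l.+1)) ->
  x 0 = 0 -> (forall l, (1 <= l <= k)%N -> ls_iterate beta z h l (x l)) ->
  qhat A b u k (x k) != 0 ->
  let Ud := mpinv (colsmx u k.+1) in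
  singval Ud 1 ^+ 2 / singval Ud k.+1 ^+ 2 - 1 = kappa Ud ^+ 2 - 1 /\
  ((qhat A b u k (x k.-1) - qhat A b u k (x k)) / qhat A b u k (x k)
     >= singval Ud 1 ^+ 2 / singval Ud k.+1 ^+ 2 - 1 ->
   norm2 (A *m x k.-1 - b) ^+ 2 >= norm2 (A *m x k - b) ^+ 2).
Proof.
move=> k_gt0 init step x0 xls.
have [rkU res] := hessenberg_residual init step.
have resx l : (l <= k)%N -> exists g, A *m x l - b = colsmx u k.+1 *m g.
  (* For l = 0 the empty combination of columns is x_0 = 0; this covers x_{k-1} when k = 1. *)
  case: l => [|l] lk.
    by have := res 0%N 0 lk; rewrite mulmx0 x0.
  by have [y [_ ->]] := xls l.+1 lk; apply: res.
have [g gE] := resx k (leqnn k); have [g' gE'] := resx k.-1 (leq_pred k).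
rewrite /qhat gE gE' => q_neq0.
exact: mpinv_residual_le.
Qed.

Theorem proposition1 (R : rcfType) :
  (forall (n : nat) (A : 'M[R]_n) (b : 'cV[R]_n) (P : nat -> 'M[R]_n)
      (k : nat) (u x : nat -> 'cV[R]_n),
    b != 0 -> (1 <= k)%N -> fcmrh A b P k u x ->
    qhat A b u k (x k) != 0 ->
    let Ud := mpinv (colsmx u k.+1) in
    singval Ud 1 ^+ 2 / singval Ud k.+1 ^+ 2 - 1 = kappa Ud ^+ 2 - 1 /\
    ((qhat A b u k (x k.-1) - qhat A b u k (x k)) / qhat A b u k (x k)
       >= singval Ud 1 ^+ 2 / singval Ud k.+1 ^+ 2 - 1 ->
     norm2 (A *m x k.-1 - b) ^+ 2 >= norm2 (A *m x k - b) ^+ 2))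
  /\
  (forall (m n : nat) (A : 'M[R]_(m, n)) (b : 'cV[R]_m) (P : nat -> 'M[R]_n)
      (k : nat) (u : nat -> 'cV[R]_m) (x : nat -> 'cV[R]_n),
    b != 0 -> (1 <= k)%N -> flslu A b P k u x ->
    qhat A b u k (x k) != 0 ->
    let Ud := mpinv (colsmx u k.+1) in
    singval Ud 1 ^+ 2 / singval Ud k.+1 ^+ 2 - 1 = kappa Ud ^+ 2 - 1 /\
    ((qhat A b u k (x k.-1) - qhat A b u k (x k)) / qhat A b u k (x k)
       >= singval Ud 1 ^+ 2 / singval Ud k.+1 ^+ 2 - 1 ->
     norm2 (A *m x k.-1 - b) ^+ 2 >= norm2 (A *m x k - b) ^+ 2)).
Proof.
split=> [n A b P k u x _ k_gt0 | m n A b P k u x _ k_gt0].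
  case=> beta [z [h [p [[_ init _ step] x0 xls]]]].
  exact: hessenberg_residual_le init step x0 xls.
case=> beta [v [z [h [t [q [g [[_ init _ _ step] x0 xls]]]]]]].
exact: hessenberg_residual_le init step x0 xls.
Qed.
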